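(* Let $G$ be a group and suppose there is a collection $\mathcal{A}$ of subgroups of $G$ that satisfies the following conditions: (1) for each $A\in\mathcal{A}$ and $g\in G$, the conjugate $g^{-1}Ag$ also belongs to $\mathcal{A}$ and there is a finite sequence $A=A_0,A_1,\dots,A_n=g^{-1}Ag$ of subgroups in $\mathcal{A}$ such that $A_{j-1}\cap A_j$ is infinite for each $j$; (2) for each $A\in\mathcal{A}$, each finite height subgroup of $A$ must be finite or have finite index in $A$. Then for each infinite index finite height subgroup $H$ of $G$, the intersection $H\cap A$ is finite for all $A\in\mathcal{A}$.
   Context: Height: the height of a subgroup $H$ of a group $G$ is the smallest number $n$ with the property that for any $n+1$ distinct left cosets $g_1H,\dots,g_{n+1}H$ the intersection $\bigcap_i g_iHg_i^{-1}$ is finite. $H$ has finite height in $G$ if such an $n$ exists. *)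

(* Defs.v *)
From HB Require Import structures.
From mathcomp Require Import all_boot.
From mathcomp Require Import boolp classical_sets functions cardinality.

Set Implicit Arguments.
Unset Strict Implicit.
Unset Printing Implicit Defensive.

Local Open Scope classical_set_scope.
Local Open Scope group_scope.

(* Groups are [groupType]s, possibly infinite; the choice structure they carry
   exists on any type by the axiom of choice.  Subgroups are classical sets of
   elements, so index and height are taken relative to an ambient subgroup [A],
   which is [setT] for the whole group. *)

Section Height.
Variable G : groupType.
Implicit Types (A H : set G) (g x : G) (n : nat).

Definition subgroup H := group_closed (mem H).

Definition lcoset g H : set G := [set g * h | h in H].

(* [h ^ g] is [g^-1 * h * g], hence [conjugate H g^-1] is g H g^-1. *)
Definition conjugate H g : set G := [set h ^ g | h in H].

Definition finite_index A H := finite_set [set lcoset g H | g in A].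

Definition height_le A H n :=
  forall g : 'I_n.+1 -> G, (forall i, A (g i)) ->
    injective (fun i => lcoset (g i) H) ->
    finite_set (\bigcap_i conjugate H (g i)^-1).

Definition has_height A H n :=
  height_le A H n /\ forall m, height_le A H m -> n <= m.

Definition finite_height A H := exists n, has_height A H n.

End Height.

(* Main.v *)
(* If H meets some A in AA in an infinite set, then H `&` A has finite height,
   hence finite index, in A.  This passes along the chains of hypothesis (1):
   when B `&` B' is infinite and H `&` B has finite index in B, then
   H `&` B' contains a finite index subgroup of B `&` B', so it is infinite.
   Thus A is virtually contained in every conjugate of H, hence in the
   intersection of any finite number of them; as H has infinitely many cosets,
   this contradicts its finite height. *)
Require Import Defs.
From mathcomp Require Import all_boot.
From mathcomp Require Import boolp classical_sets functions cardinality.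

Set Implicit Arguments.
Unset Strict Implicit.
Unset Printing Implicit Defensive.

Local Open Scope classical_set_scope.
Local Open Scope group_scope.

Section VirtualContainment.
Variable G : groupType.
Implicit Types (A B H K : set G) (g x y : G).

Lemma subgroup1 H : subgroup H -> H 1.
Proof. by case=> /set_mem. Qed.

Lemma subgroupV H x : subgroup H -> H x -> H x^-1.
Proof. by move=> /group_closedV HV /mem_set /HV /set_mem. Qed.

Lemma subgroupM H x y : subgroup H -> H x -> H y -> H (x * y).
Proof.
by move=> /group_closedM HM /mem_set Hx /mem_set Hy; apply/set_mem/HM.
Qed.

Lemma subgroupI H K : subgroup H -> subgroup K -> subgroup (H `&` K).
Proof.
move=> [H1 HD] [K1 KD]; split=> [|x y].
  by apply/mem_set; split; exact/set_mem.
move=> /set_mem[/mem_set Hx /mem_set Kx] /set_mem[/mem_set Hy /mem_set Ky].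
by apply/mem_set; split; apply/set_mem; [exact: HD|exact: KD].
Qed.

Lemma lcosetE g H x : lcoset g H x <-> H (g^-1 * x).
Proof.
split=> [[h Hh <-]|Hgx]; first by rewrite mulKg.
by exists (g^-1 * x); rewrite ?mulVKg.
Qed.

Lemma lcoset_eqP H x y : subgroup H ->
  lcoset x H = lcoset y H <-> H (x^-1 * y).
Proof.
move=> sH; split=> [eqxy|Hxy].
  by apply/lcosetE; rewrite eqxy; apply/lcosetE; rewrite mulVg; exact: subgroup1.
apply/seteqP; split=> z /lcosetE Hz; apply/lcosetE.
  have -> : y^-1 * z = (x^-1 * y)^-1 * (x^-1 * z).
    by rewrite invgM invgK -mulgA mulVKg.
  exact: subgroupM (subgroupV _ _) _.
have -> : x^-1 * z = (x^-1 * y) * (y^-1 * z) by rewrite -mulgA mulVKg.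
exact: subgroupM.
Qed.

Lemma conjugateVE H g x : conjugate H g^-1 x <-> H (x ^ g).
Proof.
split=> [[h Hh <-]|Hxg]; first by rewrite conjgKV.
by exists (x ^ g); rewrite ?conjgK.
Qed.

Lemma subgroup_conjugateV H g : subgroup H -> subgroup (conjugate H g^-1).
Proof.
move=> sH; split=> [|x y].
  by apply/mem_set/conjugateVE; rewrite conj1g; exact: subgroup1.
move=> /set_mem/conjugateVE Hx /set_mem/conjugateVE Hy.
apply/mem_set/conjugateVE; rewrite conjMg conjVg.
exact: subgroupM (subgroupV _ _).
Qed.

(* Unlike [finite_index], this does not require [H `<=` A], which makes it
   monotone in [A]; for subgroups it says that [H `&` A] has finite index
   in [A]. *)
Definition finitely_covered A H :=
  exists2 S : set G, finite_set S & A `<=` \bigcup_(x in S) lcoset x H.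

(** One representative is chosen for each of the finitely many cosets; it may lie outside [A], which
    [finitely_covered] allows. *)
Lemma finite_index_covered A H :
  subgroup H -> finite_index A H -> finitely_covered A H.
Proof.
move=> sH fin.
exists ((fun C => xget 1 [set g | lcoset g H = C]) @`
         [set lcoset g H | g in A]); first exact: finite_image.
move=> x Ax; set r := xget 1 [set g | lcoset g H = lcoset x H].
exists r; first by exists (lcoset x H) => //; exists x.
apply/lcosetE/lcoset_eqP => //.
exact: (@xgetI _ 1 [set g | lcoset g H = lcoset x H] x).
Qed.

Lemma finitely_coveredS A B K H : A `<=` B -> K `<=` H ->
  finitely_covered B K -> finitely_covered A H.
Proof.
move=> AB KH [S finS BS]; exists S => // x /AB /BS [s Ss /lcosetE Kx].
by exists s => //; apply/lcosetE/KH.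
Qed.

Lemma finitely_covered_sub A H : A `<=` H -> finitely_covered A H.
Proof.
move=> AH; exists [set 1] => // x /AH Hx.
by exists 1 => //; exists x; rewrite ?mul1g.
Qed.

(** A coset of [H] and a coset of [K] that share a point meet in the coset of their intersection
    through that point, so one point per pair of cosets suffices. *)
Lemma finitely_coveredI A H K : subgroup H -> subgroup K ->
  finitely_covered A H -> finitely_covered A K ->
  finitely_covered A (H `&` K).
Proof.
move=> sH sK [S finS AS] [T finT AT].
(* The default value 1 is taken only at pairs of disjoint cosets, which contain no point of [A] in
   common. *)
pose r st := xget 1 (lcoset st.1 H `&` lcoset st.2 K).
exists (r @` (S `*` T)); first by apply: finite_image; exact: finite_setX.
move=> x Ax; have [s Ss sx] := AS x Ax; have [t Tt tx] := AT x Ax.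
exists (r (s, t)); first by exists (s, t).
have [sr tr] : (lcoset s H `&` lcoset t K) (r (s, t)).
  exact: (@xgetI _ 1 _ x (conj sx tx)).
apply/lcosetE; split; apply/lcoset_eqP => //.
  transitivity (lcoset s H); first by apply/esym/lcoset_eqP/lcosetE.
  by apply/lcoset_eqP/lcosetE.
transitivity (lcoset t K); first by apply/esym/lcoset_eqP/lcosetE.
by apply/lcoset_eqP/lcosetE.
Qed.

Lemma finitely_covered_bigcap (I : finType) A (K : I -> set G) :
  (forall i, subgroup (K i)) -> (forall i, finitely_covered A (K i)) ->
  finitely_covered A (\bigcap_i K i).
Proof.
move=> sK AK.
suff key (s : seq I) : subgroup (\bigcap_(i in [set` s]) K i) /\
    finitely_covered A (\bigcap_(i in [set` s]) K i).
  have [_] := key (enum I); apply: finitely_coveredS => // x Kx i _.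
  by apply: Kx; rewrite /= mem_enum.
elim: s => [|i s [sKs AKs]].
  rewrite set_nil bigcap_set0; split; first by split=> [|x y _ _]; exact: mem_setT.
  exact: finitely_covered_sub.
have -> : [set` i :: s] = i |` [set` s].
  by apply/seteqP; split=> j /=; rewrite inE => /predU1P.
rewrite bigcap_setU1; split; first exact: subgroupI.
exact: finitely_coveredI.
Qed.

Lemma finitely_covered_finite A H :
  finite_set H -> finitely_covered A H -> finite_set A.
Proof.
move=> finH [S finS AS]; apply: sub_finite_set AS _.
by apply: bigcup_finite => // x _; exact: finite_image.
Qed.

(** Otherwise [A] would be a finite union of cosets of the finite set [H]&[A]. *)
Lemma finitely_covered_infiniteI A H : subgroup A -> subgroup H ->
  finitely_covered A H -> infinite_set A -> infinite_set (H `&` A).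
Proof.
move=> sA sH AH infA finHA; apply: infA; apply: finitely_covered_finite finHA _.
by apply: finitely_coveredI => //; exact: finitely_covered_sub.
Qed.

(** Conjugation by [g^-1] turns a cover of [conjugate A g] by cosets of [H] into a cover of [A] by
    cosets of [conjugate H g^-1]. *)
Lemma finitely_covered_conjugate A H g :
  finitely_covered (conjugate A g) H -> finitely_covered A (conjugate H g^-1).
Proof.
move=> [S finS AS]; exists ((fun s => s ^ g^-1) @` S); first exact: finite_image.
move=> x Ax; have [|s Ss /lcosetE Hx] := AS (x ^ g); first by exists x.
exists (s ^ g^-1); first by exists s.
by apply/lcosetE/conjugateVE; rewrite conjMg conjVg conjgKV.
Qed.

Lemma infinite_index_cosets H n : ~ finite_index setT H ->
  exists g : 'I_n -> G, injective (fun i => lcoset (g i) H).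
Proof.
rewrite /finite_index => /infiniteP /pcard_leP[f].
have fim k : exists g, lcoset g H = f k.
  have [g _ <-] : [set lcoset g H | g in setT] (f k); first exact: funS.
  by exists g.
exists (fun i => projT1 (cid (fim i))) => i j /=.
case: cid => x /= ->; case: cid => y /= -> fij.
by apply/val_inj/(@inj _ _ _ f); rewrite ?in_setT.
Qed.

(** Elements of [A] that are in distinct cosets of [H]&[A] are in distinct cosets of [H], and
    conjugates only shrink, so a bound for [H] is one for [H]&[A]. *)
Lemma finite_height_setI A H : subgroup A -> subgroup H ->
  finite_height setT H -> finite_height A (H `&` A).
Proof.
move=> sA sH [n [Hn _]].
have An : height_le A (H `&` A) n.
  move=> g Ag gI; apply: (@sub_finite_set _ _ (\bigcap_i conjugate H (g i)^-1)).
    by move=> x gx i _; have [h [Hh _] <-] := gx i I; exists h.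
  apply: Hn => // i j /lcoset_eqP Hij; apply: gI.
  apply/lcoset_eqP; first exact: subgroupI.
  by split; [exact: Hij|apply: subgroupM (subgroupV _ _) _].
(* The bound [n] may exceed the height in [A], so the least bound is extracted. *)
have ex : exists m, `[< height_le A (H `&` A) m >] by exists n; exact/asboolP.
case: (ex_minnP ex) => m /asboolP Am min_m.
by exists m; split=> // k /asboolP; exact: min_m.
Qed.

End VirtualContainment.

Theorem proposition1 (G : groupType) (AA : set (set G))
  (AA_subgroup : forall A, AA A -> subgroup A)
  (AA_conj : forall A g, AA A ->
     AA (conjugate A g) /\
     exists (n : nat) (B : nat -> set G),
       [/\ B 0%N = A, B n = conjugate A g,
           (forall j, (j <= n)%N -> AA (B j)) &
           (forall j, (j < n)%N -> infinite_set (B j `&` B j.+1))])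
  (AA_height : forall A, AA A ->
     forall K : set G, subgroup K -> K `<=` A -> finite_height A K ->
       finite_set K \/ finite_index A K)
  (H : set G) (H_subgroup : subgroup H)
  (H_index : ~ finite_index setT H)
  (H_height : finite_height setT H) :
  forall A, AA A -> finite_set (H `&` A).
Proof.
have cover A : AA A -> infinite_set (H `&` A) -> finitely_covered A H.
  move=> AAA inf; have sA := AA_subgroup _ AAA.
  have sHA := subgroupI H_subgroup sA.
  have [||//|fin] := AA_height _ AAA _ sHA; first exact: subIsetr.
    exact: finite_height_setI.
  exact: finitely_coveredS (finite_index_covered sHA fin).
move=> A AAA; apply: contrapT => inf.
have coverJ g : finitely_covered A (conjugate H g^-1).
  apply: finitely_covered_conjugate.
  have [_ [n [B [B0 <- AAB infB]]]] := AA_conj A g AAA.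
  (* Induction along the chain that joins [A] to its conjugate by [g]. *)
  suff : forall j, (j <= n)%N -> finitely_covered (B j) H by apply.
  elim=> [_|j IH ltjn]; first by rewrite B0; exact: cover.
  have sB := AA_subgroup _ (AAB _ (ltnW ltjn)).
  have sB' := AA_subgroup _ (AAB _ ltjn).
  (* By [cover], it is enough that [H] meets [B j.+1] in an infinite set. *)
  apply: cover => [|fin]; first exact: AAB.
  have BH : finitely_covered (B j `&` B j.+1) H.
    by apply: finitely_coveredS (IH (ltnW ltjn)) => //; exact: subIsetl.
  have sBB := subgroupI sB sB'.
  apply: (finitely_covered_infiniteI sBB H_subgroup BH (infB _ ltjn)).
  by apply: sub_finite_set fin => x [? []].
have [n [Hn _]] := H_height.
(* A height bound [n] concerns [n.+1] cosets. The conjugates given by these have a finite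
   intersection that virtually contains [A], which makes [A] finite. *)
have [g gI] := @infinite_index_cosets _ H n.+1 H_index.
apply: inf; apply: (@sub_finite_set _ _ A); first exact: subIsetr.
apply: finitely_covered_finite (Hn g _ gI) _ => //.
by apply: finitely_covered_bigcap => i //; exact: subgroup_conjugateV.
Qed.
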